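(* Let $(X,\rho)$ be a geometrically doubling quasi-metric space with constants $A_0,A_1$. Suppose $\delta\in(0,1)$ satisfies $96A_0^6\delta\le1$, and let a set of reference points $\{x^k_\alpha\}$, $k\in\mathbb{Z}$, $\alpha\in\mathscr{A}_k$, be given. Then there exists a finite collection of families $\mathscr{D}^t$, $t=1,2,\ldots,K$, with $K=K(A_0,A_1,\delta)<\infty$, where each $\mathscr{D}^t$ is a collection of dyadic cubes $\{Q^k_\alpha\}$ associated to dyadic points $\{z^k_\alpha\}$, $k\in\mathbb{Z}$, $\alpha\in\mathscr{A}_k$ (the points and cubes depending on $t$), having the dyadic properties (1)--(5) listed in the context. In addition, for every ball $B=B(x,r)\subseteq X$ there exist $t\in\{1,\ldots,K\}$ and $Q\in\mathscr{D}^t$ with $$B\subseteq Q\quad\text{and}\quad\operatorname{diam}(Q)\le Cr,$$ where the constant $C<\infty$ depends only on $A_0$ and $\delta$.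
   Context: A quasi-metric $\rho$ on $X$ satisfies the axioms of a metric except that the triangle inequality is weakened to $\rho(x,y)\le A_0(\rho(x,z)+\rho(z,y))$ with $A_0\ge1$. Balls are $B(x,r):=\{y\in X:\rho(y,x)<r\}$, $r>0$. Geometric doubling: there is $A_1\in\mathbb{N}$ such that every ball $B(x,r)$ can be covered by at most $A_1$ balls of radius $r/2$. A set $\Omega$ is open if each $x\in\Omega$ has some $B(x,\varepsilon)\subseteq\Omega$, $\varepsilon>0$; interior and closure refer to this topology. $\operatorname{diam}(Q):=\sup_{x,y\in Q}\rho(x,y)$. Reference points (for the given $\delta$): for every $k\in\mathbb{Z}$ a family $\{x^k_\alpha\}_{\alpha\in\mathscr{A}_k}\subseteq X$ with $\rho(x^k_\alpha,x^k_\beta)\ge\delta^k$ for $\alpha\ne\beta$ and $\min_\alpha\rho(x,x^k_\alpha)<\delta^k$ for all $x\in X$. Dyadic properties, with $c_0:=(4A_0^2)^{-1}$, $C_0:=2A_0$, $c_1:=(3A_0^2)^{-1}c_0$, $C_1:=2A_0C_0$: there are sets $\tilde Q^k_\alpha\subseteq Q^k_\alpha\subseteq\bar Q^k_\alpha$ ($k\in\mathbb{Z}$, $\alpha\in\mathscr{A}_k$) such that (1) $\tilde Q^k_\alpha$ and $\bar Q^k_\alpha$ are the interior and closure of $Q^k_\alpha$; (2) if $\ell\ge k$, then either $Q^\ell_\beta\subseteq Q^k_\alpha$ or $Q^k_\alpha\cap Q^\ell_\beta=\varnothing$; (3) $X=\bigcup_\alpha Q^k_\alpha$ (disjoint union)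 for every $k\in\mathbb{Z}$; (4) $B(z^k_\alpha,c_1\delta^k)\subseteq Q^k_\alpha\subseteq B(z^k_\alpha,C_1\delta^k)=:B(Q^k_\alpha)$; (5) if $k\le\ell$ and $Q^\ell_\beta\subseteq Q^k_\alpha$, then $B(Q^\ell_\beta)\subseteq B(Q^k_\alpha)$. *)

(* Defs.v *)
From HB Require Import structures.
From mathcomp Require Import all_boot all_order all_algebra.
From mathcomp Require Import boolp classical_sets reals constructive_ereal ereal.
From mathcomp Require Import topology.

Set Implicit Arguments.
Unset Strict Implicit.
Unset Printing Implicit Defensive.

Import Order.TTheory GRing.Theory Num.Theory.

Local Open Scope classical_set_scope.
Local Open Scope ring_scope.

Record quasi_metric (R : realType) (X : Type) (A0 : R) (rho : X -> X -> R)
    : Prop := QuasiMetric {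
  qm_ge0 : forall x y, 0 <= rho x y ;
  qm_eq0 : forall x y, rho x y = 0 <-> x = y ;
  qm_sym : forall x y, rho x y = rho y x ;
  qm_A0_ge1 : 1 <= A0 ;
  qm_triangle : forall x y z, rho x y <= A0 * (rho x z + rho z y)
}.

Section Quasimetric.
Variables (R : realType) (X : Type) (rho : X -> X -> R).

Definition qball (x : X) (r : R) : set X := [set y | rho y x < r].

Definition geom_doubling (A1 : nat) : Prop :=
  forall (x : X) (r : R), 0 < r ->
    exists2 n : nat, (n <= A1)%N &
      exists c : 'I_n -> X, qball x r `<=` \bigcup_i qball (c i) (r / 2).

(* Supremum in the extended reals: +oo for unbounded Q (and -oo for Q empty). *)
Definition qdiam (Q : set X) : \bar R :=
  ereal_sup [set (rho p.1 p.2)%:E | p in Q `*` Q].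

Definition qopen (O : set X) : Prop :=
  forall x, O x -> exists2 e : R, 0 < e & qball x e `<=` O.

Lemma qopenT : qopen setT.
Proof. by move=> x _; exists 1. Qed.

Lemma qopenI : setI_closed qopen.
Proof.
move=> A B oA oB x [/oA[e e0 eA] /oB[f f0 fB]].
exists (Num.min e f); first by rewrite lt_min e0.
by move=> y; rewrite /qball /= lt_min => /andP[ye yf]; split;
  [exact: eA | exact: fB].
Qed.

Lemma qopen_bigU (I : Type) (f : I -> set X) :
  (forall i, qopen (f i)) -> qopen (\bigcup_i f i).
Proof.
move=> of_ x [i _ /of_[e e0 ef]]; exists e => // y /ef fy.
by exists i.
Qed.

End Quasimetric.

(* A copy of X that carries the topology of rho. The balls themselves need not
   be open for a quasi-metric, so rho does not make X a pseudometric space. *)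
Definition qspace (R : realType) (X : Type) (rho : X -> X -> R) : Type := X.

Section Qspace.
Variables (R : realType) (X : Type) (rho : X -> X -> R).

HB.instance Definition _ := gen_eqMixin (qspace rho).
HB.instance Definition _ := gen_choiceMixin (qspace rho).
HB.instance Definition _ := isOpenTopological.Build (qspace rho)
  (qopenT rho) (@qopenI R X rho) (@qopen_bigU R X rho).

Lemma open_qspaceE : (open : set (qspace rho) -> Prop) = qopen rho.
Proof.
apply/funext => U; apply/propext; split.
  rewrite openE => oU x /oU [V [oV Vx VU]].
  by have [e e0 eV] := oV x Vx; exists e => // y /eV /VU.
by move=> oU; rewrite openE => x Ux; exists U; split.
Qed.

End Qspace.

Section Dyadic.
Variables (R : realType) (A0 delta : R) (X : Type) (rho : X -> X -> R).
Variable A : int -> Type.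

Record reference_points (x : forall k, A k -> X) : Prop := ReferencePoints {
  ref_separated : forall k (a b : A k), a <> b ->
    delta ^ k <= rho (x k a) (x k b) ;
  (* a is an index at which the minimum of rho y (x k _) is attained *)
  ref_dense : forall k (y : X), exists a : A k,
    (forall b : A k, rho y (x k a) <= rho y (x k b)) /\
    rho y (x k a) < delta ^ k
}.

Definition c0 : R := (4 * A0 ^+ 2)^-1.
Definition C0 : R := 2 * A0.
Definition c1 : R := (3 * A0 ^+ 2)^-1 * c0.
Definition C1 : R := 2 * A0 * C0.

Definition cube_ball (z : forall k, A k -> X) (k : int) (a : A k) : set X :=
  qball rho (z k a) (C1 * delta ^ k).

Record dyadic_cubes (z : forall k, A k -> X) (Qo Q Qc : forall k, A k -> set X)
    : Prop := DyadicCubes {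
  dy_sub : forall k (a : A k), Qo k a `<=` Q k a /\ Q k a `<=` Qc k a ;
  dy_interior : forall k (a : A k),
    Qo k a = interior (Q k a : set (qspace rho)) ;
  dy_closure : forall k (a : A k),
    Qc k a = closure (Q k a : set (qspace rho)) ;
  dy_nested : forall k l (a : A k) (b : A l), k <= l ->
    Q l b `<=` Q k a \/ Q k a `&` Q l b = set0 ;
  dy_cover : forall k, \bigcup_(a : A k) Q k a = setT ;
  dy_disjoint : forall k, trivIset setT (Q k) ;
  dy_ball_sub : forall k (a : A k),
    qball rho (z k a) (c1 * delta ^ k) `<=` Q k a ;
  dy_sub_ball : forall k (a : A k), Q k a `<=` cube_ball z a ;
  dy_ball_nested : forall k l (a : A k) (b : A l), k <= l ->
    Q l b `<=` Q k a -> cube_ball z b `<=` cube_ball z a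
}.

End Dyadic.

(* Main.v *)
Require Import Defs.
From mathcomp Require Import all_boot all_order all_algebra.
From mathcomp Require Import boolp classical_sets reals constructive_ereal ereal.
From mathcomp Require Import topology.
From mathcomp Require Import ring lra zify.
Import Order.TTheory GRing.Theory Num.Theory.
Local Open Scope classical_set_scope.
Local Open Scope ring_scope.

(** Two independent constructions are combined.

    Cubes from points.  Let points [z k a] be [c * delta ^ k]-separated and
    [C * delta ^ k]-dense at every level [k].  Give every point of the space a
    parent index at each level: the [a] whose [z k a] is very close if there is
    one (separation makes it unique), and otherwise any [a] with [z k a] at
    distance less than [C * delta ^ k].  Starting from [y] at a deep level [m]
    and climbing from parent to parent leads to an ancestor of [y] at level [k].
    The distance from [y] to this ancestor is less than
    [2 * A0 * C * delta ^ k] whatever [m] is, since [delta] is so small that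
    each step of the climb dominates all the previous ones
    ([ancestor_lt]).  By doubling only finitely many indices are that close,
    so an ultrafilter on the starting levels [m] that contains the cofinite
    sets selects one of them, the address of [y] at level [k].  The same
    ultrafilter serves all levels, hence the address at level [k] is the parent
    of the address at level [k + 1] ([address_parent]).  The cube of [a] is the
    set of points of address [a]: cubes of one level partition the space, and
    two points with the same address at a level have the same address at all
    coarser levels, which is nestedness.  The precedence given to very
    close parents yields the inner ball ([address_eq]).

    Adjacent systems.  A ball of radius at most [delta ^ (k + 1)] lies in a
    cube of level [k] as soon as the dyadic point of that cube is the reference
    point [x (k + 1) b] nearest to the centre, for the inner ball of the cube
    is then large enough.  So it suffices to find finitely many families of
    dyadic points such that each [x (k + 1) b] is a dyadic point of level [k] in
    one of them.  A single family cannot use them all, as it has to be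
    separated at scale [delta ^ k]; but by doubling boundedly many of them
    conflict with a given one, so they can be coloured with boundedly many
    colours without conflict inside a colour ([colouring]).  The family of a
    colour is obtained from the points [x k a] by moving [x k a] onto a point
    of that colour that has [x k a] as its nearest reference point of level
    [k], if there is one ([shifted_points]). *)

Set Implicit Arguments.
Unset Strict Implicit.
Unset Printing Implicit Defensive.

(** * Covering and counting in a doubling space *)

Section Covering.
Variables (R : realType) (A0 : R) (X : Type) (rho : X -> X -> R) (A1 : nat).
Hypotheses (qm : quasi_metric A0 rho) (doubling : geom_doubling rho A1).

Lemma doubling_cover (x : X) (r : R) : 0 < r ->
  exists c : 'I_A1 -> X, qball rho x r `<=` \bigcup_i qball rho (c i) (r / 2).
Proof.
move=> r0; have [n nA1 [c cover]] := doubling x r0.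
have [i0 _ _] : (\bigcup_i qball rho (c i) (r / 2)) x.
  by apply: cover; rewrite /qball /= (qm_eq0 qm x x).2.
(* A covering by fewer than A1 balls is padded with one of its own members;
   it has one because the covered ball contains its centre. *)
exists (fun i => if insub (i : nat) is Some j then c j else c i0).
move=> y /cover [i _ yi]; exists (widen_ord nA1 i) => //=.
by case: insubP => [j _ ji|]; rewrite ?ltn_ord // (_ : j = i) //; apply: val_inj.
Qed.

Lemma iterated_doubling_cover (m : nat) (x : X) (r : R) : 0 < r ->
  exists2 T : finType, #|T| = (A1 ^ m)%N &
    exists c : T -> X,
      qball rho x r `<=` \bigcup_t qball rho (c t) (r / 2 ^+ m).
Proof.
move=> r0; elim: m => [|m [T cardT [c cover]]].
  exists unit; first by rewrite card_unit.
  by exists (fun=> x) => y xy; exists tt; rewrite ?expr0 ?divr1.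
have rm0 : 0 < r / 2 ^+ m by rewrite divr_gt0 // exprn_gt0.
have [d cover_d] := choice (fun t => doubling_cover (c t) rm0).
exists (T * 'I_A1)%type; first by rewrite card_prod card_ord cardT expnSr.
exists (fun p => d p.1 p.2) => y /cover[t _ /cover_d[i _ yi]].
by exists (t, i) => //=; rewrite exprSr invfM mulrA.
Qed.

(** Pieces of diameter less than [s] contain at most one point of an
    [s]-separated family: this bounds separated families, and also makes
    ultrafilter limits of such families exist. *)
Lemma small_cover (m : nat) (x : X) (r s : R) : 0 < r ->
  2 * A0 * r <= s * 2 ^+ m ->
  exists2 T : finType, #|T| = (A1 ^ m)%N &
    exists2 P : T -> set X, qball rho x r `<=` \bigcup_t P t &
      forall t y y', P t y -> P t y' -> rho y y' < s.
Proof.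
move=> r0 rs; have [T cardT [c cover]] := iterated_doubling_cover m x r0.
exists T => //; exists (fun t => qball rho (c t) (r / 2 ^+ m)) => // t y y'.
rewrite /qball /= => yc y'c; apply: (le_lt_trans (qm_triangle qm y y' (c t))).
rewrite (qm_sym qm (c t)).
have p0 : 0 < 2 ^+ m :> R by rewrite exprn_gt0.
rewrite -ler_pdivrMr // -mulrA in rs; apply: lt_le_trans rs.
have := qm_A0_ge1 qm; nra.
Qed.

Lemma separated_card_le (m n : nat) (x : X) (r s : R) (f : 'I_n -> X) :
  0 < r -> 2 * A0 * r <= s * 2 ^+ m ->
  (forall i, qball rho x r (f i)) ->
  (forall i j, i != j -> s <= rho (f i) (f j)) -> (n <= A1 ^ m)%N.
Proof.
move=> r0 rs fx fsep; have [T <- [P cover small]] := small_cover x r0 rs.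
have [i|g gP] := choice (P := fun i t => P t (f i)).
  by have [t _ ?] := cover _ (fx i); exists t.
rewrite -[n in (n <= _)%N]card_ord; apply: (@leq_card _ _ g) => i j gij.
apply/eqP/negPn/negP => /fsep; rewrite leNgt => /negP; apply.
by apply: (small (g i)); rewrite ?[in P (g i) (f j)]gij.
Qed.

End Covering.

(** * Colouring a graph of bounded degree *)

Section Colouring.
Variables (V : Type) (E : V -> V -> Prop).

Definition independent (I : set V) :=
  forall u v, I u -> I v -> u <> v -> ~ E u v.

(** The union of a chain of independent sets is independent, since any two of
    its vertices lie in one member of the chain. *)
Lemma maximal_independent (S : set V) : exists2 I : set V,
  I `<=` S /\ independent I &
  forall v, S v -> I v \/ exists2 u, I u & E v u \/ E u v.
Proof.
have [|I [[IS indI] maxI]] :=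
  @Zorn_bigcup V [set I | I `<=` S /\ independent I].
  move=> F FP tot; split=> [v [J /FP[JS _]]|u v [J FJ Ju] [K FK Kv] uv].
    exact: JS.
  have [JK|KJ] := tot _ _ FJ FK.
    by have [_] := FP _ FK; apply=> //; apply: JK.
  by have [_] := FP _ FJ; apply=> //; apply: KJ.
exists I => // v Sv; apply: contrapT => /not_orP[nIv nE].
apply: (maxI (I `|` [set v])); last split.
- by split=> [|sub]; [move=> ?; left | apply: nIv; apply: sub; right].
- by move=> u [/IS//|->].
- move=> u w [Iu|->] [Iw|->] // neq; first exact: indI.
  + by move=> uv; apply: nE; exists u; last right.
  + by move=> vw; apply: nE; exists w; last left.
Qed.

(** Peel off maximal independent sets one after another.  A vertex that
    survives [N] rounds could have been added to none of them, so it has a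
    neighbour in each, and these [N] neighbours are distinct because the sets
    are disjoint.  Since [E] is reflexive, a vertex counts among its own
    neighbours. *)
Lemma colouring (N : nat) :
  (forall u v, E u v -> E v u) -> (forall v, E v v) ->
  (forall v (f : 'I_N -> V), injective f -> (forall i, E v (f i)) -> False) ->
  exists2 I : 'I_N -> set V,
    forall i, independent (I i) & forall v, exists i, I i v.
Proof.
move=> Esym Erefl degree.
have [S|M /all_and2[MP Mmax]] := choice (P := fun S I : set V =>
    (I `<=` S /\ independent I) /\ forall v, S v -> exists2 u, I u & E v u).
  have [I IP Imax] := maximal_independent S.
  exists I; split=> // v /Imax [Iv|[u Iu [|/Esym] vu]]; first by exists v.
  + by exists u.
  + by exists u.
(* U n collects the vertices removed in the first n rounds. *)
pose U := fix U n := if n is n'.+1 then U n' `|` M (~` U n') else set0.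
have Umono i j : (i <= j)%N -> U i `<=` U j.
  elim: j => [|j IH]; first by rewrite leqn0 => /eqP->.
  by rewrite leq_eqVlt => /orP[/eqP-> //|/IH sub v /sub ?]; left.
exists (fun i : 'I_N => M (~` U i)) => [i|v]; first by case: (MP (~` U i)).
apply: contrapT => nv.
have UN n : (n <= N)%N -> ~ U n v.
  elim: n => [_ []|n IH ltnN [Un|Mv]]; first exact: IH (ltnW ltnN) Un.
  by apply: nv; exists (Ordinal ltnN).
have [i|f fP] := choice (P := fun (i : 'I_N) u => M (~` U i) u /\ E v u).
  have [u Mu vu] := Mmax (~` U i) v (UN i (ltnW (ltn_ord i))).
  by exists u.
have fneq (i j : 'I_N) : (i < j)%N -> f i <> f j.
  move=> ij fij; have [Mj _] := fP j; have [+ _] := MP (~` U j) => /(_ _ Mj).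
  apply; apply: (Umono i.+1 j ij); right; rewrite -fij; exact: (fP i).1.
apply: (degree v f) => [i j fij|i]; last exact: (fP i).2.
apply: val_inj; case: (ltngtP i j) => // /fneq; first by move/(_ fij).
by rewrite fij.
Qed.

End Colouring.

(** * Geometric scales *)

Lemma scale_between (R : realType) (delta r : R) : 0 < delta -> delta <= 1 / 2 -> 0 < r ->
  exists k : int, delta ^ (k + 1) <= r <= delta ^ k.
Proof.
move=> d0 d2 r0.
have small (e : R) : 0 < e -> exists n : nat, delta ^+ n < e.
  move=> e0; exists (Num.bound e^-1).
  have /lt_le_trans := upper_nthrootP (leqnn (Num.bound e^-1)).
  set n := Num.bound _ => h.
  have: delta ^+ n <= (2 ^+ n)^-1.
    by rewrite -exprVn lerXn2r ?nnegrE ?invr_ge0 ?(ltW d0) // -[2^-1]mul1r.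
  move=> /le_lt_trans; apply; rewrite -[e]invrK ltf_pV2 ?posrE ?exprn_gt0 ?invr_gt0 //.
  exact: h.
have dn0 : delta != 0 by rewrite gt_eqF.
have [M HM] := small r^-1 (ltac:(by rewrite invr_gt0)).
(* Starting from level - M, where the scale exceeds r, take the first level
   whose scale is below r. *)
have ex : exists n : nat, delta ^ (n%:Z - M%:Z) < r.
  have [n Hn] := small r r0; exists (n + M)%N.
  by rewrite PoszD addrK -exprnP.
have [n Hn nmin] := find_ex_minn ex.
case: n Hn nmin => [|n] Hn nmin.
  move: Hn; rewrite add0r -[_ ^ _]exprnN => Hn.
  move: HM; rewrite -(ltf_pV2) ?posrE ?invr_gt0 ?exprn_gt0 // invrK.
  by move/(lt_trans Hn); rewrite ltxx.
exists (n%:Z - M%:Z); apply/andP; split.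
  by rewrite addrAC -[n%:Z + 1]/((n + 1)%N%:Z) addn1 ltW.
by rewrite leNgt; apply/negP => /nmin; rewrite ltnn.
Qed.

(** * Dyadic cubes from separated dense points *)

Lemma ultra_finite_cover (I : Type) (U : set_system I) (T : finType)
    (P : T -> set I) :
  UltraFilter U -> U (\bigcup_t P t) -> exists t, U (P t).
Proof.
move=> ultraU UP; apply: contrapT => nP.
have UC : U [set i | forall t, (~` P t) i].
  apply: filter_forall => t.
  by have [UPt|//] := in_ultra_setVsetC (P t) ultraU; case: nP; exists t.
by have [i [[t _ Pti] /(_ t)]] := filter_ex (filterI UP UC); apply.
Qed.

Lemma abszB_succ (m : nat) (k : int) : k < m%:Z ->
  `|(m%:Z - k)%R|%N = `|(m%:Z - (k + 1))%R|%N.+1.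
Proof. lia. Qed.

Section Cubes.
Variables (R : realType) (A0 delta c C : R) (X : Type) (rho : X -> X -> R).
Variables (A1 : nat) (A : int -> Type) (z : forall k, A k -> X).
Hypotheses (qm : quasi_metric A0 rho) (doubling : geom_doubling rho A1).
Hypotheses (delta_gt0 : 0 < delta) (c_gt0 : 0 < c) (c_le_C : c <= C).
Hypothesis delta_small : 12 * A0 ^+ 3 * C * delta <= c.
Hypothesis separated : forall k (a b : A k), a <> b ->
  c * delta ^ k <= rho (z a) (z b).
Hypothesis dense : forall k (y : X), exists a : A k,
  rho y (z a) < C * delta ^ k.

Let A0_ge1 : 1 <= A0 := qm_A0_ge1 qm.
Let A0_gt0 : 0 < A0 := lt_le_trans ltr01 A0_ge1.
Let C_gt0 : 0 < C := lt_le_trans c_gt0 c_le_C.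
Let scale_gt0 k : 0 < delta ^ k := exprz_gt0 k delta_gt0.

Let scaleS k : delta ^ (k + 1) = delta ^ k * delta.
Proof. by rewrite expfzDr ?gt_eqF. Qed.

Let scale_step k : 12 * A0 ^+ 3 * C * delta ^ (k + 1) <= c * delta ^ k.
Proof. by rewrite scaleS mulrCA mulrC ler_wpM2r ?(ltW (scale_gt0 k)) // mulrC. Qed.

(** Points closer than [c * delta ^ k / (2 * A0)] to a given [x] are closer
    than [c * delta ^ k] to each other, so by separation there is only one. *)
Lemma parent_exists k (x : X) : exists a : A k, rho x (z a) < C * delta ^ k /\
  forall b : A k, 2 * A0 * rho x (z b) < c * delta ^ k -> a = b.
Proof.
have [[a near_a]|far] :=
  pselect (exists a : A k, 2 * A0 * rho x (z a) < c * delta ^ k).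
  exists a; split=> [|b near_b].
    have x0 := qm_ge0 qm x (z a); apply: le_lt_trans (_ : 2 * A0 * rho x (z a) < _).
      have := A0_ge1; nra.
    by apply: lt_le_trans near_a _; rewrite ler_wpM2r // ltW.
  apply: contrapT => /separated; rewrite leNgt => /negP; apply.
  apply: le_lt_trans (qm_triangle qm _ _ x) _; rewrite (qm_sym qm (z a)); lra.
have [a near_a] := dense k x; exists a; split=> // b near_b.
by case: far; exists b.
Qed.

Definition parent k (x : X) : A k := sval (cid (parent_exists k x)).

Lemma parent_lt k x : rho x (z (parent k x)) < C * delta ^ k.
Proof. exact: (svalP (cid (parent_exists k x))).1. Qed.

Lemma parent_eq k x (b : A k) :
  2 * A0 * rho x (z b) < c * delta ^ k -> parent k x = b.
Proof. exact: (svalP (cid (parent_exists k x))).2. Qed.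

(** The bound [2 * A0 * C * delta ^ k] reproduces itself from one level to the
    next coarser one: as [2 * A0 * delta <= 1], both sides of the triangle
    through [x] are shorter than [C * delta ^ k]. *)
Lemma parent_dist k x y : rho y x < 2 * A0 * C * delta ^ (k + 1) ->
  rho y (z (parent k x)) < 2 * A0 * C * delta ^ k.
Proof.
move=> yx; apply: le_lt_trans (qm_triangle qm _ _ x) _.
have xp := parent_lt k x; have step := scale_step k.
have k0 := scale_gt0 k; have k1 := scale_gt0 (k + 1).
have yx' : rho y x < C * delta ^ k.
  apply: (lt_le_trans yx); apply: le_trans (_ : c * delta ^ k <= _); last first.
    by rewrite ler_wpM2r // ltW.
  apply: le_trans step; rewrite !ler_wpM2r ?(ltW k1) ?(ltW C_gt0) //.
  have := ler_eXnr (isT : (0 < 3)%N) A0_ge1; have := A0_ge1; lra.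
have -> : 2 * A0 * C * delta ^ k = A0 * (2 * (C * delta ^ k)) by ring.
rewrite ltr_pM2l //; lra.
Qed.

(** The climb starts at level [k + n]; letting [n] decrease while the level
    increases keeps the index in the type [A k] without casts. *)
Fixpoint ancestor n k (y : X) : A k :=
  if n is n'.+1 then parent k (z (ancestor n' (k + 1) y)) else parent k y.

Lemma ancestor_lt n k y :
  rho y (z (ancestor n k y)) < 2 * A0 * C * delta ^ k.
Proof.
elim: n k => [|n IH] k /=; last exact: parent_dist.
apply: lt_le_trans (parent_lt k y) _.
rewrite ler_wpM2r ?(ltW (scale_gt0 k)) // ler_peMl ?(ltW C_gt0) //.
have := A0_ge1; lra.
Qed.

(** The next-to-last point [w] of the climb is much closer to [y] than
    [c * delta ^ k], so if [y] is close to [z a] then [w] is close enough for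
    its parent to be forced.  This is where the constant [12] of the smallness
    hypothesis is used in full. *)
Lemma ancestor_eq n k y (a : A k) :
  3 * A0 ^+ 2 * rho y (z a) < c * delta ^ k -> ancestor n.+1 k y = a.
Proof.
move=> ya /=; set w := z (ancestor n (k + 1) y); apply: parent_eq.
have yw : 6 * A0 ^+ 2 * rho w y < c * delta ^ k.
  rewrite (qm_sym qm); apply: lt_le_trans (scale_step k).
  rewrite (_ : 12 * A0 ^+ 3 * C * _ =
    6 * A0 ^+ 2 * (2 * A0 * C * delta ^ (k + 1))); last by ring.
  by rewrite ltr_pM2l ?ancestor_lt // mulr_gt0 // exprn_gt0.
apply: le_lt_trans (_ : 2 * A0 * (A0 * (rho w y + rho y (z a))) < _); last by lra.
by rewrite ler_wpM2l ?mulr_ge0 ?(ltW A0_gt0) // (qm_triangle qm).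
Qed.

Section Address.
Variable U : set_system nat.
Hypotheses (ultraU : UltraFilter U) (cofinalU : \oo%classic `<=` U).

(** The ancestors of [y] at level [k] range over a ball covered by finitely
    many pieces, each containing at most one [z a]; the ultrafilter picks a
    piece, hence an index. *)
Lemma address_exists k y :
  exists a : A k, U [set m : nat | ancestor `|m%:Z - k| k y = a].
Proof.
have k0 := scale_gt0 k; have C0 := C_gt0.
pose r := 2 * A0 * C * delta ^ k.
have r0 : 0 < r by rewrite !mulr_gt0.
pose m := Num.bound (2 * A0 * (2 * A0 * C) / c).
have rm : 2 * A0 * r <= c * delta ^ k * 2 ^+ m.
  have := upper_nthrootP (leqnn m); rewrite ltr_pdivrMr // => /ltW h.
  by rewrite /r mulrA [leRHS]mulrAC ler_wpM2r ?(ltW k0) // [leRHS]mulrC.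
have [T _ [P cover small]] := small_cover qm doubling y r0 rm.
have [t Ut] : exists t,
    U [set m : nat | P t (z (ancestor `|m%:Z - k| k y))].
  apply: ultra_finite_cover; apply: filterS filterT => j _.
  have [|t _ Pt] := cover (z (ancestor `|j%:Z - k| k y)); last by exists t.
  by rewrite /qball /= (qm_sym qm); exact: ancestor_lt.
have [j Pj] := filter_ex Ut.
exists (ancestor `|j%:Z - k| k y); apply: filterS Ut => i Pi.
apply: contrapT => /separated; rewrite leNgt => /negP; apply.
exact: small Pi Pj.
Qed.

Definition address k (y : X) : A k := sval (cid (address_exists k y)).

Lemma addressP k y :
  U [set m : nat | ancestor `|m%:Z - k| k y = address k y].
Proof. exact: svalP (cid (address_exists k y)). Qed.

Lemma deep_level k : U [set m : nat | k < m%:Z].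
Proof.
apply: cofinalU; exists `|k|%N.+1 => // m /= km.
by apply: le_lt_trans (lez_abs k) _; rewrite ltz_nat.
Qed.

(** For [m > k] the climb from level [m] to level [k] passes through the
    ancestor at level [k + 1], and the limits at the two levels are taken along
    the same ultrafilter. *)
Lemma address_parent k y : address k y = parent k (z (address (k + 1) y)).
Proof.
have [m [[/= <- <-] km]] := filter_ex
  (filterI (filterI (addressP k y) (addressP (k + 1) y)) (deep_level k)).
by rewrite abszB_succ.
Qed.

Lemma address_lt k y : rho y (z (address k y)) < 2 * A0 * C * delta ^ k.
Proof.
by have [m /= <-] := filter_ex (addressP k y); exact: ancestor_lt.
Qed.

Lemma address_eq k y (a : A k) :
  3 * A0 ^+ 2 * rho y (z a) < c * delta ^ k -> address k y = a.
Proof.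
move=> ya; have [m [/= <- km]] := filter_ex (filterI (addressP k y) (deep_level k)).
rewrite abszB_succ //.
exact: ancestor_eq.
Qed.

Lemma address_coarsen k l x y : k <= l ->
  address l x = address l y -> address k x = address k y.
Proof.
rewrite -subr_ge0; case E : (l - k) => [n|//] _.
have {E} -> : l = k + n%:Z by rewrite -E addrC subrK.
elim: n k => [|n IH] k; first by rewrite addr0.
rewrite intS addrA => /IH xy.
by rewrite (address_parent k x) (address_parent k y) xy.
Qed.

Lemma address_ball k l x : k <= l ->
  qball rho (z (address l x)) (2 * A0 * C * delta ^ l) `<=`
  qball rho (z (address k x)) (2 * A0 * C * delta ^ k).
Proof.
rewrite -subr_ge0; case E : (l - k) => [n|//] _.
have {E} -> : l = k + n%:Z by rewrite -E addrC subrK.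
elim: n k => [|n IH] k y; first by rewrite addr0.
by rewrite intS addrA => /IH; rewrite /qball /= (address_parent k); exact: parent_dist.
Qed.

End Address.

Lemma dyadic_addresses : exists adr : forall k, X -> A k, [/\
  forall k y, rho y (z (adr k y)) < 2 * A0 * C * delta ^ k,
  forall k y (a : A k), 3 * A0 ^+ 2 * rho y (z a) < c * delta ^ k -> adr k y = a,
  forall k l x y, k <= l -> adr l x = adr l y -> adr k x = adr k y &
  forall k l x, k <= l ->
    qball rho (z (adr l x)) (2 * A0 * C * delta ^ l) `<=`
    qball rho (z (adr k x)) (2 * A0 * C * delta ^ k)].
Proof.
have [U [ultraU cofinalU]] := ultraFilterLemma eventually_filter.
exists (address ultraU); split.
- exact: address_lt.
- exact: address_eq.
- exact: address_coarsen.
- exact: address_ball.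
Qed.

End Cubes.

(** * Adjacent families of dyadic points *)

Section Systems.
Variables (R : realType) (A0 delta : R) (X : Type) (rho : X -> X -> R).
Variables (A1 : nat) (A : int -> Type).
Hypotheses (qm : quasi_metric A0 rho) (doubling : geom_doubling rho A1).
Hypotheses (delta_gt0 : 0 < delta) (delta_small : 96 * A0 ^+ 6 * delta <= 1).

Let A0_ge1 : 1 <= A0 := qm_A0_ge1 qm.
Let A0_gt0 : 0 < A0 := lt_le_trans ltr01 A0_ge1.

(** With [c = c0 A0] and [C = C0 A0] the smallness condition
    [12 * A0 ^+ 3 * C * delta <= c] reads [96 * A0 ^+ 6 * delta <= 1].  Each
    cube contains its dyadic point, so an inclusion between cubes identifies
    the address of the finer dyadic point at the coarser level. *)
Lemma dyadic_cubes_exist (z : forall k, A k -> X) :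
  (forall k (a b : A k), a <> b -> c0 A0 * delta ^ k <= rho (z k a) (z k b)) ->
  (forall k y, exists a : A k, rho y (z k a) < C0 A0 * delta ^ k) ->
  exists Q : forall k, A k -> set X,
    dyadic_cubes A0 delta rho z (fun k a => interior (Q k a : set (qspace rho)))
      Q (fun k a => closure (Q k a : set (qspace rho))).
Proof.
move=> separated dense.
have A02 : 0 < A0 ^+ 2 by rewrite exprn_gt0.
have c0_gt0 : 0 < c0 A0 by rewrite invr_gt0 mulr_gt0.
have c0_le_C0 : c0 A0 <= C0 A0.
  rewrite /c0 /C0 -div1r ler_pdivrMr ?mulr_gt0 //.
  have := ler_eXnr (isT : (0 < 3)%N) A0_ge1; have := A0_ge1; lra.
have small : 12 * A0 ^+ 3 * C0 A0 * delta <= c0 A0.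
  rewrite /c0 -[leRHS]div1r ler_pdivlMr ?mulr_gt0 // /C0.
  by apply: le_trans delta_small; rewrite le_eqVlt; apply/orP; left; apply/eqP; ring.
(* adr k y is the index of the cube of level k that contains y. *)
have [adr [adr_lt adr_eq adr_coarsen adr_ball]] := dyadic_addresses qm doubling
  delta_gt0 c0_gt0 c0_le_C0 small separated dense.
have adrK k (a : A k) : adr k (z k a) = a.
  by apply: adr_eq; rewrite (qm_eq0 qm _ _).2 // mulr0 mulr_gt0 // exprz_gt0.
exists (fun k a => [set y | adr k y = a]); split=> //.
- move=> k a; split; first exact: (@interior_subset (qspace rho)).
  exact: (@subset_closure (qspace rho)).
- move=> k l a b kl; have [<-|ba] := pselect (adr k (z l b) = a).
    by left=> y /= yb; apply: (adr_coarsen _ _ _ _ kl); rewrite yb adrK.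
  right; apply/seteqP; split=> // y [/= ya yb]; apply: ba; rewrite -ya.
  by apply: (adr_coarsen _ _ _ _ kl); rewrite yb adrK.
- by move=> k; apply/seteqP; split=> // y _; exists (adr k y).
- by move=> k a b _ _ [y [/= <- <-]].
- move=> k a y; rewrite /qball /= => ya; apply: adr_eq.
  by rewrite -ltr_pdivlMl ?mulr_gt0 // mulrA.
- by move=> k a y /= <-; exact: adr_lt.
- move=> k l a b kl sub; have := adr_ball _ _ (z l b) kl.
  by rewrite adrK (sub (z l b) (adrK l b)).
Qed.

Variable x : forall k, A k -> X.
Hypothesis ref : reference_points delta rho x.

Let scale_gt0 k : 0 < delta ^ k := exprz_gt0 k delta_gt0.

(** Two points that have moved are far apart by independence, two that have
    not by the separation of the reference points.  If [x b] has replaced its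
    nearest reference point, then it is at distance at least
    [delta ^ k / (2 * A0)] from any other [x a'], as otherwise [x a'] and the
    nearest point would be too close.  Points with the same nearest reference
    point are closer than [2 * A0 * delta ^ k], the conflict distance; hence at
    most one of them is in [I], and each point of [I] is attained. *)
Lemma shifted_points k (I : set (A (k + 1))) :
  independent (fun b b' => rho (x b) (x b') < 2 * A0 * delta ^ k) I ->
  exists z : A k -> X, [/\
    forall a a', a <> a' -> c0 A0 * delta ^ k <= rho (z a) (z a'),
    forall a, rho (x a) (z a) < delta ^ k &
    forall b, I b -> exists a, z a = x b].
Proof.
move=> indI.
have [b|par parP] := choice (P := fun (b : A (k + 1)) (a : A k) =>
    (forall a' : A k, rho (x b) (x a) <= rho (x b) (x a')) /\
    rho (x b) (x a) < delta ^ k); first exact: (ref_dense ref).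
have [a|z zP] := choice (P := fun (a : A k) y =>
    (exists b, [/\ I b, par b = a & y = x b]) \/
    (forall b, I b -> par b <> a) /\ y = x a).
  have [[b Ib ba]|nb] := pselect (exists2 b, I b & par b = a).
    by exists (x b); left; exists b.
  by exists (x a); right; split=> // b Ib ba; apply: nb; exists b.
have c0_small u : delta ^ k <= 2 * A0 * u -> c0 A0 * delta ^ k <= u.
  move=> h; rewrite /c0 mulrC ler_pdivrMr ?mulr_gt0 ?exprn_gt0 //.
  apply: (le_trans h); have k0 := scale_gt0 k.
  have u0 : 0 <= u.
    rewrite -(pmulr_rge0 u (mulr_gt0 (ltr0Sn R 1) A0_gt0)).
    exact: le_trans (ltW k0) h.
  rewrite mulrC ler_wpM2l //.
  have := ler_eXnr (isT : (0 < 2)%N) A0_ge1; have := A0_ge1; lra.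
have A02_ge1 : 1 <= 2 * A0 by have := A0_ge1; lra.
have c0_le u : delta ^ k <= u -> c0 A0 * delta ^ k <= u.
  move=> h; apply: c0_small; apply: (le_trans h).
  by rewrite ler_peMl // (le_trans (ltW (scale_gt0 k))).
have mixed b a' : par b <> a' -> c0 A0 * delta ^ k <= rho (x b) (x a').
  move=> ne; apply: c0_small; have [near _] := parP b.
  apply: le_trans (ref_separated ref ne) _.
  apply: le_trans (qm_triangle qm _ _ (x b)) _; rewrite (qm_sym qm (x (par b))).
  by rewrite [2 * A0]mulrC -mulrA ler_wpM2l ?(ltW A0_gt0) // mulr_natl mulr2n lerD2r.
exists z; split=> [a a' ne|a|b Ib].
- have [[b [Ib ba ->]]|[na ->]] := zP a; have [[b' [Ib' ba' ->]]|[na' ->]] := zP a'.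
  + have /(indI _ _ Ib Ib') : b <> b' by move=> bb; apply: ne; rewrite -ba bb.
    move=> /negP; rewrite -leNgt => h; apply: c0_le; apply: le_trans h.
    by rewrite ler_peMl // ltW.
  + by apply: mixed; rewrite ba.
  + by rewrite (qm_sym qm); apply: mixed; rewrite ba' => /esym.
  + by apply: c0_le; exact: (ref_separated ref ne).
- have [[b [Ib <- ->]]|[_ ->]] := zP a.
    by rewrite (qm_sym qm); have [_] := parP b.
  by rewrite (qm_eq0 qm _ _).2.
- exists (par b); have [[b' [Ib' bb' ->]]|[/(_ b Ib)//]] := zP (par b).
  have [->//|ne] := pselect (b' = b).
  case: (indI _ _ Ib' Ib ne).
  apply: le_lt_trans (qm_triangle qm _ _ (x (par b))) _.
  have [_] := parP b; have [_] := parP b'; rewrite bb' (qm_sym qm (x (par b))) => lt1 lt2.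
  by rewrite [2 * A0]mulrC -mulrA ltr_pM2l // mulr_natl mulr2n ltrD.
Qed.

(** A ball of radius [2 * A0 * delta ^ k] contains at most [A1 ^ N] points that
    are [delta ^ (k + 1)]-separated, so one more colour is enough. *)
Lemma adjacent_points k (N : nat) :
  2 * A0 * (2 * A0) <= delta * 2 ^+ N ->
  exists z : 'I_(A1 ^ N).+1 -> A k -> X, [/\
    forall t a a', a <> a' -> c0 A0 * delta ^ k <= rho (z t a) (z t a'),
    forall t a, rho (x a) (z t a) < delta ^ k &
    forall b : A (k + 1), exists t a, z t a = x b].
Proof.
move=> N_large; have k0 := scale_gt0 k.
have r0 : 0 < 2 * A0 * delta ^ k by rewrite !mulr_gt0.
have [|b|b f f_inj fb|I indI coverI] := @colouring (A (k + 1))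
    (fun b b' => rho (x b) (x b') < 2 * A0 * delta ^ k) (A1 ^ N).+1.
- by move=> u v; rewrite (qm_sym qm).
- by rewrite (qm_eq0 qm _ _).2.
- suff : ((A1 ^ N).+1 <= A1 ^ N)%N by rewrite ltnn.
  apply: (@separated_card_le _ _ _ _ _ qm doubling N _ (x b) _
    (delta ^ (k + 1)) (fun i => x (f i)) r0).
  + by rewrite expfzDr ?gt_eqF // mulrA -[leRHS]mulrA [leRHS]mulrC ler_wpM2r // ltW.
  + by move=> i; rewrite /qball /= (qm_sym qm).
  + by move=> i j ij; apply: (ref_separated ref) => /f_inj /eqP; apply/negP.
have [z zP] := choice (fun t => shifted_points (indI t)).
exists z; split=> [t|t|b]; try by have [] := zP t.
have [t Ib] := coverI b; exists t; by have [_ _] := zP t; apply.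
Qed.

End Systems.

Theorem theorem4p1 (R : realType) (A0 delta : R)
  (A0_ge1 : 1 <= A0) (delta_gt0 : 0 < delta) (delta_lt1 : delta < 1)
  (delta_small : 96 * A0 ^+ 6 * delta <= 1) :
  exists C : R, forall A1 : nat, exists K : nat,
    forall (X : Type) (rho : X -> X -> R),
      quasi_metric A0 rho -> geom_doubling rho A1 ->
    forall (A : int -> Type) (x : forall k : int, A k -> X),
      reference_points delta rho x ->
    exists (z : 'I_K -> forall k : int, A k -> X)
           (Qo Q Qc : 'I_K -> forall k : int, A k -> set X),
      (forall t : 'I_K,
         dyadic_cubes A0 delta rho (z t) (Qo t) (Q t) (Qc t)) /\
      (forall (y : X) (r : R), 0 < r ->
         exists (t : 'I_K) (k : int) (a : A k),
           qball rho y r `<=` Q t k a /\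
           (qdiam rho (Q t k a) <= (C * r)%:E)%E).
Proof.
have A0_gt0 : 0 < A0 := lt_le_trans ltr01 A0_ge1.
have scale_gt0 k : 0 < delta ^ k := exprz_gt0 k delta_gt0.
have scaleS k : delta ^ (k + 1) = delta ^ k * delta by rewrite expfzDr ?gt_eqF.
pose N := Num.bound (2 * A0 * (2 * A0) / delta).
have N_large : 2 * A0 * (2 * A0) <= delta * 2 ^+ N.
  by rewrite [leRHS]mulrC -ler_pdivrMr // ltW // upper_nthrootP.
exists (2 * A0 * C1 A0 / delta ^+ 2) => A1; exists (A1 ^ N).+1.
move=> X rho qm doubling A x ref.
pose z t k := sval (cid (adjacent_points qm doubling delta_gt0 ref k N_large)) t.
have zP k := svalP (cid (adjacent_points qm doubling delta_gt0 ref k N_large)).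
have [t|Q QP] := choice (P := fun t Q => dyadic_cubes A0 delta rho (z t)
    (fun k a => interior (Q k a : set (qspace rho))) Q
    (fun k a => closure (Q k a : set (qspace rho)))).
  apply: (dyadic_cubes_exist qm doubling) => // k => [|y].
    by have [+ _ _] := zP k => /(_ t).
  have [a [_ ya]] := ref_dense ref k y; exists a.
  have [_ /(_ t a) za _] := zP k.
  apply: le_lt_trans (qm_triangle qm _ _ (x k a)) _.
  by rewrite /C0 [2 * A0]mulrC -mulrA ltr_pM2l // mulr_natl mulr2n ltrD.
exists z, (fun t k a => interior (Q t k a : set (qspace rho))), Q,
  (fun t k a => closure (Q t k a : set (qspace rho))); split=> // y r r0.
(* The level k = j - 1 satisfies delta ^ (k + 2) <= r <= delta ^ (k + 1). *)
have [|j /andP[]] := scale_between delta_gt0 _ r0.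
  have := exprn_ege1 6 A0_ge1; nra.
rewrite -(subrK 1 j); set k := j - 1 => r_ge r_le.
have [b [_ yb]] := ref_dense ref (k + 1) y.
have [_ _ /(_ b) [t [a]]] := zP k; rewrite -/(z t k) => zab.
exists t, k, a; split.
  move=> w; rewrite /qball /= => wy; apply: (dy_ball_sub (QP t)).
  rewrite /qball /= zab; apply: le_lt_trans (qm_triangle qm _ _ y) _.
  apply: lt_le_trans (_ : A0 * (2 * delta ^ (k + 1)) <= _).
    by rewrite ltr_pM2l // mulr_natl mulr2n ltrD // (lt_le_trans wy).
  (* This amounts to 24 * A0 ^+ 5 * delta <= 1. *)
  rewrite scaleS [delta ^ k * _]mulrC !mulrA ler_wpM2r ?(ltW (scale_gt0 k)) //.
  rewrite /c1 /c0 -invfM -[leRHS]div1r ler_pdivlMr ?mulr_gt0 ?exprn_gt0 //.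
  apply: le_trans delta_small.
  have -> : 96 * A0 ^+ 6 * delta =
    4 * A0 * (A0 * 2 * delta * (3 * A0 ^+ 2 * (4 * A0 ^+ 2))) by ring.
  rewrite ler_peMl //; last by lra.
  by rewrite !mulr_ge0 ?exprn_ge0 ?ltW.
apply: ge_ereal_sup => _ [[p q] [/= Qp Qq] <-]; rewrite lee_fin.
have := dy_sub_ball (QP t) Qp; have := dy_sub_ball (QP t) Qq.
rewrite /cube_ball /qball /= => pz qz.
apply: le_trans (qm_triangle qm _ _ (z t k a)) _.
rewrite (qm_sym qm (z t k a)).
apply: le_trans (_ : A0 * (2 * (C1 A0 * delta ^ k)) <= _).
  by rewrite ler_wpM2l ?(ltW A0_gt0) // mulr_natl mulr2n lerD // ltW.
have -> : A0 * (2 * (C1 A0 * delta ^ k)) = 2 * A0 * C1 A0 * delta ^ k by ring.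
have C1_ge0 : 0 <= C1 A0 by rewrite /C1 /C0 !mulr_ge0 // ltW.
rewrite -[leRHS]mulrA ler_wpM2l ?mulr_ge0 ?(ltW A0_gt0) //.
by rewrite ler_pdivlMl ?exprn_gt0 // mulrC expr2 mulrA -!scaleS.
Qed.
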